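(* For each integer $n\ge1$ let \[ A_n(\mathbf{x})=\sum_{\pi\in \mathrm{RSP}(n)}\ \prod_{j\in\mathrm{DES}(\pi)} x_{n-j} \] (a polynomial in commuting variables $x_1,x_2,\dots$; descents are indexed from the end). Then for all $n\ge1$, \[ A_n(\mathbf{x})=1+\sum_{i=1}^{n-2}\left(\binom{n-1}{i}-1\right)x_iA_i(\mathbf{x}), \] and for all $n\ge 2$, \[ A_n(\mathbf{x})=A_{n-1}(\mathbf{x})+\sum_{i=1}^{n-2}\binom{n-2}{i-1}x_iA_i(\mathbf{x}). \]
   Context: For a permutation $\pi\in S_n$ in one-line notation $\pi(1)\dotsm\pi(n)$, $k\in[n-1]$ is a descent if $\pi(k)>\pi(k+1)$; $\mathrm{DES}(\pi)$ is the set of descents. The runs of $\pi$ are its maximal increasing contiguous subwords (so $\pi$ with $r-1$ descents is the concatenation of $r$ runs). $\mathrm{runsort}(\pi)$ is the permutation obtained by rearranging the runs of $\pi$ in lexicographic order (for permutations: in increasing order of their first entries). $\mathrm{RSP}(n)=\{\mathrm{runsort}(\sigma):\sigma\in S_n\}$, the set of run-sorted permutations of $[n]$ (also called flattened partitions). Empty sums are $0$. *)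

(* Defs.v *)
From HB Require Import structures.
From mathcomp Require Import all_boot all_order all_fingroup all_algebra.
From mathcomp Require Import monalg.

Set Implicit Arguments.
Unset Strict Implicit.
Unset Printing Implicit Defensive.

Import Order.TTheory GRing.Theory.

Local Open Scope ring_scope.

Section Runs.
Variables (d : Order.disp_t) (T : orderType d).
Implicit Types (x : T) (w r : seq T) (rs : seq (seq T)).

Fixpoint runs w : seq (seq T) :=
  if w is x :: w' then
    if runs w' is (y :: r) :: rs then
      if (x < y)%O then (x :: y :: r) :: rs else [:: x] :: (y :: r) :: rs
    else [:: [:: x]]
  else [::].

(* The four lemmas below characterise [runs w]: it cuts w into nonempty
   increasing blocks, none of which can be extended into the next one. *)
Lemma runs_nonempty w : [::] \notin runs w.
Proof.
elim: w => //= x w.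
case: (runs w) => [|[|y r] rs] //=; rewrite !inE //= => H.
by case: ifP => _; rewrite !inE.
Qed.

Lemma flatten_runs w : flatten (runs w) = w.
Proof.
elim: w => //= x w; have := runs_nonempty w.
case: (runs w) => [|[|y r] rs] //= _ <- //.
by case: ifP.
Qed.

Lemma sorted_runs w : all (sorted <%O) (runs w).
Proof.
elim: w => //= x w.
case: (runs w) => [|[|y r] rs] //= /andP [Hr Hrs].
by case: ifP => xy /=; rewrite ?xy Hr.
Qed.

Lemma runs_maximal w :
  sorted (fun r r' => if r' is y :: _ then (y <= last y r)%O else true) (runs w).
Proof.
elim: w => //= x w.
case: (runs w) => [|[|y r] rs] //= H.
case: ifP => xy /=; last by rewrite leNgt xy.
by case: rs H => [|[|z r'] rs] //=.
Qed.

Definition runsort_word w : seq T :=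
  flatten (sort (fun r r' => ((r : seqlexi T) <= (r' : seqlexi T))%O) (runs w)).

Lemma perm_runsort_word w : perm_eq (runsort_word w) w.
Proof.
rewrite -[X in perm_eq _ X]flatten_runs /runsort_word.
by apply: perm_flatten; rewrite perm_sort.
Qed.

End Runs.

Section RunSorted.
Variable n : nat.
Implicit Types p : 'S_n.

(* Positions and letters are 0-based here: the letters 0, ..., n-1 stand for
   1, ..., n. *)
Definition oneline p : seq 'I_n := [seq p i | i <- enum 'I_n].

Lemma size_oneline p : size (oneline p) = n.
Proof. by rewrite size_map size_enum_ord. Qed.

Lemma runsort_inj p :
  injective (fun i : 'I_n => nth i (runsort_word (oneline p)) i).
Proof.
move=> i j; set w := runsort_word _.
have pw : perm_eq w (oneline p) := perm_runsort_word _.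
have szw : size w = n by rewrite (perm_size pw) size_oneline.
have uw : uniq w by rewrite (perm_uniq pw) map_inj_uniq ?enum_uniq //; exact: perm_inj.
rewrite (set_nth_default i j) ?szw // => /eqP.
by rewrite nth_uniq ?szw // => /eqP/val_inj.
Qed.

Definition runsort p : 'S_n := perm (@runsort_inj p).

Lemma oneline_runsort p : oneline (runsort p) = runsort_word (oneline p).
Proof.
have szw : size (runsort_word (oneline p)) = n.
  by rewrite (perm_size (perm_runsort_word _)) size_oneline.
case: (posnP n) => [n0|n_gt0].
  have nil0 (s : seq 'I_n) : s = [::].
    case: s => // x s; suff: (x < 0)%N by [].
    by have := ltn_ord x; rewrite [X in (_ < X)%N -> _]n0.
  by rewrite [LHS]nil0 [RHS]nil0.
pose x0 := Ordinal n_gt0.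
apply: (@eq_from_nth _ x0); rewrite size_oneline ?szw // => i ltin.
rewrite (nth_map x0) ?size_enum_ord // permE (nth_enum_ord _ ltin).
by apply: set_nth_default; rewrite szw.
Qed.

Definition RSP : {set 'S_n} := runsort @: [set: 'S_n].

(* Descents are numbered as in the usual convention for words p(1)...p(n):
   k is a descent when p(k) > p(k+1), the k-th and (k+1)-st letters being
   p i and p k in the 0-based indexing, where i + 1 = k. In particular the
   ordinal 0 is never a descent. *)
Definition DES p : {set 'I_n} :=
  [set k : 'I_n | [exists i : 'I_n, (i.+1 == k :> nat) && (p k < p i)%N]].

End RunSorted.

(* Polynomials over the integers in commuting variables indexed by nat; the
   monoid algebra of the free commutative monoid on nat, so that, unlike in
   {mpoly int[m]}, the set of variables does not depend on n. *)
Definition polyring := {malg int[{cmonom nat}]}.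
HB.instance Definition _ := GRing.ComNzRing.on polyring.

Definition X (i : nat) : polyring := mkmalgU (ucm i) 1.

Definition A (n : nat) : polyring :=
  \sum_(p in RSP n) \prod_(j in DES p) X (n - j)%N.

(* Main.v *)
(* A run-sorted word on a nonempty set of letters a < s_1 < ... < s_k starts
   with a. Unless it is increasing, it is (a T) w, where a T is its first run
   and w is an arbitrary run-sorted word on the complement U of T in s, subject
   only to max (a T) > min U. For each i = |U| this fails for exactly one T,
   the set of the k - i smallest letters of s (for U empty, it always fails);
   the descent between a T and w contributes x_i. This gives
   A_n = 1 + \sum_i ('C(n-1, i) - 1) x_i A_i, and the second recurrence is
   the difference of two instances of the first one, by Pascal's rule. *)

Require Import Defs.
From HB Require Import structures.
From mathcomp Require Import all_boot all_order all_fingroup all_algebra.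

Set Implicit Arguments.
Unset Strict Implicit.
Unset Printing Implicit Defensive.

Import Order.TTheory GRing.Theory.

Local Open Scope ring_scope.

(** * Run decompositions and run-sorted words over an ordered alphabet *)

Section RunSortedWords.
Variables (d : Order.disp_t) (T : orderType d).
Implicit Types (x y : T) (w r s : seq T) (rs : seq (seq T)) (m : bitseq).

(* Totalised so as to be transitive: the empty block precedes all others. *)
Definition head_le r r' :=
  if r is x :: _ then if r' is y :: _ then (x <= y)%O else false else true.

(** An intrinsic criterion that does not mention sorting; [mem_RSP] identifies it with lying in the
    image of [runsort]. *)
Definition runsorted w := sorted head_le (runs w).

Lemma runsE x w : runs (x :: w) =
  if runs w is (y :: r) :: rs then
    if (x < y)%O then (x :: y :: r) :: rs else [:: x] :: (y :: r) :: rs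
  else [:: [:: x]].
Proof. by []. Qed.

Lemma runs_cons x w : exists r rs, runs (x :: w) = (x :: r) :: rs.
Proof.
rewrite /=; case: (runs w) (runs_nonempty w) => [|[|y r] rs] //= _.
- by exists [::], [::].
- by case: ifP => _; [exists (y :: r), rs | exists [::], ((y :: r) :: rs)].
Qed.

Lemma runs_split x w r rs : runs (x :: w) = (x :: r) :: rs ->
  [/\ path <%O x r, w = r ++ flatten rs, runs (flatten rs) = rs
    & if flatten rs is y :: _ then (y <= last x r)%O else true].
Proof.
elim: w x r rs => [|z w IHw] x r rs; first by case=> <- <-.
have [r1 [rs1 E]] := runs_cons z w.
have [Hp Ew Hr Hl] := IHw _ _ _ E.
rewrite runsE E; case: ifP => xz [<- <-].
  by rewrite /= xz Hp Hr -Ew; split.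
have -> : flatten ((z :: r1) :: rs1) = z :: w by rewrite /= -Ew.
by rewrite E leNgt xz.
Qed.

Lemma runs_path x r : path <%O x r -> runs (x :: r) = [:: x :: r].
Proof.
elim: r x => [|y r IHr] x // /andP[xy Hr].
by rewrite runsE IHr // xy.
Qed.

Lemma runs_cat x r y w : path <%O x r -> (y <= last x r)%O ->
  runs (x :: r ++ y :: w) = (x :: r) :: runs (y :: w).
Proof.
have [r1 [rs1 E]] := runs_cons y w.
elim: r x => [|z r IHr] x.
  by move=> _ yx; rewrite cat0s runsE E ltNge yx.
case/andP=> xz Hr Hl.
by rewrite cat_cons runsE IHr // xz.
Qed.

Lemma runs_cat_lt x r y w r1 rs1 : path <%O x r -> (last x r < y)%O ->
  runs (y :: w) = (y :: r1) :: rs1 ->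
  runs (x :: r ++ y :: w) = (x :: r ++ y :: r1) :: rs1.
Proof.
move=> Hr Hl E; elim: r x Hr Hl => [|z r IHr] x.
  by move=> _ xy; rewrite cat0s runsE E xy.
case/andP=> xz Hr Hl.
by rewrite cat_cons runsE IHr // xz.
Qed.

Lemma runsorted_path x r : path <%O x r -> runsorted (x :: r).
Proof. by move=> Hr; rewrite /runsorted runs_path. Qed.

Lemma runsorted_cat x r y w : path <%O x r -> (y <= last x r)%O ->
  runsorted (x :: r ++ y :: w) = (x <= y)%O && runsorted (y :: w).
Proof.
move=> Hr Hl; rewrite /runsorted runs_cat //.
by have [r1 [rs1 ->]] := runs_cons y w.
Qed.

Lemma runsorted_split x w : runsorted (x :: w) ->
  path <%O x w \/ exists r y w', [/\ w = r ++ y :: w', path <%O x r,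
    (y <= last x r)%O, (x <= y)%O & runsorted (y :: w')].
Proof.
have [r [rs E]] := runs_cons x w.
have [Hp Ew Hr Hl] := runs_split E; rewrite {1}/runsorted E {}Ew.
case: (flatten rs) Hr Hl => [|y w'] Hr Hl Hs; first by left; rewrite cats0.
right; exists r, y, w'; have [r1 [rs1 E1]] := runs_cons y w'.
rewrite /runsorted Hr.
by move: Hs; rewrite -Hr E1 /= => /andP[].
Qed.

(** The letter [x] bounds its own run from below, and the head of the second run, which by induction
    is minimal in the rest. *)
Lemma runsorted_min x w : runsorted (x :: w) -> all (>= x)%O w.
Proof.
(* Induction on a bound for the length, because the recursive call skips a whole run instead of one
   letter. *)
move: {2}(size w) (leqnn (size w)) => k; elim: k => [|k IHk] in x w *.
  by rewrite leqn0 size_eq0 => /eqP->.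
move=> Hk /runsorted_split[/(order_path_min lt_trans)|].
  by apply: sub_all => z /ltW.
move=> [r [y [w' [Ew Hr Hl xy Hw]]]]; rewrite Ew all_cat /= xy.
rewrite (sub_all _ (order_path_min lt_trans Hr)) => [|z /ltW //].
have := IHk _ _ _ Hw; rewrite (leq_trans _ (_ : size w - 1 <= k)%N).
- by move=> /(_ isT); apply: sub_all => z; exact: le_trans.
- by rewrite Ew size_cat /= addnS subn1 leq_addl.
- by rewrite leq_subLR.
Qed.

(** The blocks need not be the runs of their concatenation, since neighbours may merge. A merger
    only removes the head of the later block, and the remaining heads stay ordered by
    transitivity. *)
Lemma runsorted_flatten rs : [::] \notin rs -> all (sorted <%O) rs ->
  sorted head_le rs -> runsorted (flatten rs).
Proof.
elim: rs => [|[|x r] rs IHrs] //; rewrite inE /= => H0 /andP[Hr Hrs] Hs.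
have := IHrs H0 Hrs (path_sorted Hs).
case: rs H0 Hs {IHrs Hrs} => [|[|y r'] rs] //=.
  by move=> *; rewrite cats0 runsorted_path.
move=> _ /andP[xy _] Hw; case: (leP y (last x r)) => Hl.
  by rewrite runsorted_cat // xy.
have [r1 [rs1 E]] := runs_cons y (r' ++ flatten rs).
move: Hw; rewrite /runsorted (runs_cat_lt Hr Hl E) E.
case: rs1 {E} => [|[|z r2] rs1] //= /andP[yz ->].
by rewrite (le_trans xy yz).
Qed.

Lemma runsorted_runsort_word w : runsorted (runsort_word w).
Proof.
rewrite /runsort_word; set leL := fun _ _ => _.
apply: runsorted_flatten; rewrite ?mem_sort ?runs_nonempty //.
  by rewrite all_sort sorted_runs.
have /sub_sorted : subrel leL head_le.
  move=> [|x r] [|y r'] //=; rewrite /leL ?lexi0 //.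
  by rewrite lexi_cons => /andP[].
by apply; apply: sort_sorted => r r'; apply: le_total.
Qed.

(** Distinct letters give distinct heads, so the order of heads decides the lexicographic order and
    the list of runs is already sorted. *)
Lemma runsort_word_id w : uniq w -> runsorted w -> runsort_word w = w.
Proof.
move=> uw Hw; rewrite /runsort_word; set leL := fun _ _ => _.
suff Hs : sorted leL (runs w).
  rewrite sorted_sort ?flatten_runs // => r1 r2 r3; exact: le_trans.
move: Hw (runs_nonempty w); rewrite /runsorted.
have : uniq (flatten (runs w)) by rewrite flatten_runs.
elim: (runs w) => [|r [|r' rs] IHrs] //=; rewrite inE negb_or.
case: r r' IHrs => [|x r] [|y r'] //= IHrs.
rewrite mem_cat inE !negb_or => /andP[/andP[_ /andP[xy _]] U].
case/andP=> lexy Hs H0; apply/andP; split.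
  by rewrite /leL lexi_cons lexy leNgt lt_neqAle xy lexy.
apply: IHrs => //.
by move: U; rewrite cat_uniq => /and3P[].
Qed.

End RunSortedWords.

(** * Bit masks as an encoding of subsets of a word, and their enumeration *)

Section Masks.
Variable T : eqType.
Implicit Types (s : seq T) (m : bitseq).

Lemma map_mem_mask s m : uniq s -> size m = size s ->
  [seq x \in mask m s | x <- s] = m.
Proof.
case: s => [|x0 s] us szm; first by case: m szm.
apply: (@eq_from_nth _ false); rewrite size_map // => i lti.
by rewrite (nth_map x0) // in_mask // mem_nth // index_uniq.
Qed.

Lemma perm_mask_negb s m : size m = size s ->
  perm_eq (mask m s ++ mask (map negb m) s) s.
Proof.
elim: s m => [|x s IHs] [|b m] //= [/IHs {}IHs].
by case: b; rewrite /= ?perm_cons // -cat1s perm_catCA perm_cons.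
Qed.

Lemma mask_true_false s k : (k <= size s)%N ->
  mask (nseq k true ++ nseq (size s - k) false) s = take k s.
Proof.
move=> lek; have sztk : size (take k s) = k by rewrite size_takel.
rewrite -[X in mask _ X](cat_take_drop k s) mask_cat ?size_nseq // mask_true ?sztk //.
by rewrite mask_false cats0.
Qed.

Lemma mask_false_true s k : (k <= size s)%N ->
  mask (nseq k false ++ nseq (size s - k) true) s = drop k s.
Proof.
move=> lek; have sztk : size (take k s) = k by rewrite size_takel.
rewrite -[X in mask _ X](cat_take_drop k s) mask_cat ?size_nseq //.
rewrite mask_true ?size_drop //.
by rewrite mask_false.
Qed.

(** Selected letters followed by the others give back [s] only if the selected ones form a prefix;
    this leaves one mask for each number of unselected letters. *)
Lemma mask_cat_negbP s m : uniq s -> size m = size s ->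
  (mask m s ++ mask (map negb m) s == s) =
  (m == nseq (size s - count negb m) true ++ nseq (count negb m) false).
Proof.
move=> us szm; set c := count negb m.
have ck : (size s - c)%N = count id m.
  by rewrite -szm -(count_predC id m) addnK.
have lek : (size s - c <= size s)%N by rewrite leq_subr.
have Ec : c = (size s - (size s - c))%N.
  by rewrite subKn // -szm count_size.
rewrite {2}Ec; apply/eqP/eqP => [E|->]; last first.
  rewrite map_cat !map_nseq mask_true_false // mask_false_true //.
  by rewrite cat_take_drop.
(* A mask is determined by the letters that it selects, so comparing the two selections is
   enough. *)
rewrite -(map_mem_mask us szm).
have -> : mask m s = mask (nseq (size s - c) true
                         ++ nseq (size s - (size s - c)) false) s.
  by rewrite mask_true_false // -[X in take _ X]E ck take_size_cat // size_mask.
by rewrite map_mem_mask // size_cat !size_nseq subnKC.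
Qed.

End Masks.

(** A mask corresponds to the set of positions that it leaves out. *)
Lemma card_tuple_count n i :
  #|[set m : n.-tuple bool | count negb m == i]| = 'C(n, i).
Proof.
rewrite -[n in 'C(n, i)]card_ord -card_draws.
pose f (m : n.-tuple bool) := [set j | ~~ tnth m j].
have f_inj : injective f.
  move=> m1 m2 /setP E; apply: eq_from_tnth => j.
  by have := E j; rewrite !inE => /negb_inj.
rewrite -(card_imset _ f_inj); apply: eq_card => J; rewrite inE.
have cardf m : #|f m| = count negb m.
  rewrite cardE size_filter -enumT /= -[in RHS](map_tnth_enum m) count_map.
  by apply: eq_count => j; rewrite /= inE.
apply/imsetP/eqP => [[m] | cJ]; first by rewrite inE => /eqP <- ->.
have EJ : J = f [tuple j \notin J | j < n].
  by apply/setP => j; rewrite inE tnth_mktuple negbK.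
by exists [tuple j \notin J | j < n]; rewrite // inE -cJ {2}EJ cardf.
Qed.

(** * Descent weights, and splitting off the first run *)

Section Weight.
Variables (R : comNzRingType) (v : nat -> R).
Variables (d : Order.disp_t) (T : orderType d).
Implicit Types (x y : T) (w r s : seq T) (m : bitseq).

(** A descent is indexed by the number of letters after it, so the weight of a suffix does not
    depend on what precedes it. *)
Fixpoint weight w : R :=
  if w is x :: w' then
    (if w' is y :: _ then if (y < x)%O then v (size w') else 1 else 1)
      * weight w'
  else 1.

Lemma weight_cons x y w :
  weight (x :: y :: w) =
    (if (y < x)%O then v (size w).+1 else 1) * weight (y :: w).
Proof. by []. Qed.

Lemma weight_path x r : path <%O x r -> weight (x :: r) = 1.
Proof.
elim: r x => [|y r IHr] x; first by rewrite /= mulr1.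
by case/andP=> xy /IHr E; rewrite weight_cons E lt_gtF // mulr1.
Qed.

Lemma weight_cat x r y w : path <%O x r -> (y < last x r)%O ->
  weight (x :: r ++ y :: w) = v (size w).+1 * weight (y :: w).
Proof.
elim: r x => [|z r IHr] x; first by move=> _ /= ->.
case/andP=> xz Hr Hl.
by rewrite !cat_cons weight_cons -cat_cons IHr // lt_gtF // mul1r.
Qed.

Definition runsorted_perms s := [seq w <- permutations s | runsorted w].

(* The mask m marks the letters of s that belong to the first run. *)
Definition split_perms a s :=
  [seq a :: mask m s ++ w
     | m <- [seq m : bitseq <- map val (enum {:(size s).-tuple bool})
               | mask m s ++ mask (map negb m) s != s],
       w <- runsorted_perms (mask (map negb m) s)].

(** Both pieces are increasing, so their concatenation can differ from the sorted word [s] only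
    through a drop at the junction. *)
Lemma mask_descent a s m : path <%O a s -> size m = size s ->
  (mask m s ++ mask (map negb m) s != s) =
  (if mask (map negb m) s is y :: _ then (y <= last a (mask m s))%O else false).
Proof.
move=> Hs szm.
have -> : (mask m s ++ mask (map negb m) s == s) =
          path <%O a (mask m s ++ mask (map negb m) s).
  apply/eqP/idP => [->//|/path_sorted Ht].
  apply: (lt_sorted_eq Ht (path_sorted Hs)).
  exact: (perm_mem (perm_mask_negb szm)).
rewrite cat_path lt_path_mask //=.
have := path_sorted (lt_path_mask (map negb m) Hs).
by case: (mask _ _) => [|y U] //= ->; rewrite andbT -leNgt.
Qed.

Lemma runsorted_perm_head s y U w : sorted <%O s -> s = y :: U ->
  perm_eq w s -> runsorted w -> exists w', w = y :: w'.
Proof.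
move=> Hs Es; case: w => [|z w] Pw Hw; first by have := perm_size Pw; rewrite Es.
exists w; congr (_ :: _); apply: le_anti.
have := perm_mem Pw.
have /= /allP := runsorted_min Hw => minw mem.
have := mem z; have := mem y; rewrite Es !inE !eqxx /= => Hy Hz.
apply/andP; split.
  by case/orP: Hy => [/eqP->//|/minw].
move: Hs; rewrite Es /= => /lt_path_min /allP minU.
by case/esym/orP: Hz => [/eqP->//|/minU/ltW].
Qed.

(** No word is listed twice, since [runs] returns its first run, which determines the mask and the
    rest. *)
Lemma perm_runsorted_perms a s : path <%O a s ->
  perm_eq (runsorted_perms (a :: s)) ((a :: s) :: split_perms a s).
Proof.
move=> Hs; have us := lt_sorted_uniq (path_sorted Hs).
have memsplit w : reflect (exists m w', [/\ size m = size s,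
    mask m s ++ mask (map negb m) s != s,
    perm_eq w' (mask (map negb m) s), runsorted w' & w = a :: mask m s ++ w'])
    (w \in split_perms a s).
  apply: (iffP allpairsPdep) => [] [m [w' []]].
    rewrite mem_filter => /andP[Hm /mapP[m' _ Em]].
    rewrite mem_filter mem_permutations => /andP[Hw' Pw'] ->.
    by exists m, w'; split; rewrite // Em size_tuple.
  move=> szm Hm Pw' Hw' ->; exists m, w'; split => //.
    rewrite mem_filter Hm; apply/mapP.
    by exists (Tuple (introT eqP szm)); rewrite ?mem_enum.
  by rewrite mem_filter mem_permutations Hw'.
(* The rest starts with the least unselected letter, which does not exceed the last selected one:
   hence [a :: mask m s] really is the first run. *)
have split_runs m w' : size m = size s ->
    mask m s ++ mask (map negb m) s != s -> perm_eq w' (mask (map negb m) s) ->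
    runsorted w' -> exists y u, [/\ w' = y :: u, (y \in s),
      path <%O a (mask m s) & (y <= last a (mask m s))%O].
  move=> szm; rewrite (mask_descent Hs) //.
  case EU: (mask (map negb m) s) => [|y U] // Hl Pw' Hw'.
  have sU : sorted <%O (mask (map negb m) s).
    exact: lt_sorted_mask (path_sorted Hs).
  have [u Ew'] := runsorted_perm_head sU EU (etrans (congr1 _ EU) Pw') Hw'.
  exists y, u; split; rewrite // ?lt_path_mask //.
  by apply: (@mem_mask _ _ (map negb m)); rewrite EU mem_head.
apply: uniq_perm => [|/=|w].
- by rewrite filter_uniq // permutations_uniq.
- apply/andP; split.
    apply/negP => /memsplit[m [w' [szm Hm Pw' Hw' [Es]]]].
    have [y [u [Ew' _ _ Hl]]] := split_runs _ _ szm Hm Pw' Hw'.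
    by move: Hs; rewrite Es Ew' cat_path /= ltNge Hl andbF.
  apply: allpairs_uniq_dep => [|m _|].
  + by rewrite filter_uniq // map_inj_uniq ?enum_uniq //; exact: val_inj.
  + by rewrite filter_uniq // permutations_uniq.
  move=> p q /allpairsPdep[m1 [w1 []]]; rewrite mem_filter.
  case/andP=> Hm1 /mapP[m1' _ Em1]; have szm1 : size m1 = size s.
    by rewrite Em1 size_tuple.
  rewrite mem_filter mem_permutations => /andP[Hw1 Pw1] -> {p}.
  case/allpairsPdep=> [m2 [w2 []]]; rewrite mem_filter.
  case/andP=> Hm2 /mapP[m2' _ Em2]; have szm2 : size m2 = size s.
    by rewrite Em2 size_tuple.
  rewrite mem_filter mem_permutations => /andP[Hw2 Pw2] -> {q} /= E.
  have [y1 [u1 [E1 _ p1 l1]]] := split_runs _ _ szm1 Hm1 Pw1 Hw1.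
  have [y2 [u2 [E2 _ p2 l2]]] := split_runs _ _ szm2 Hm2 Pw2 Hw2.
  (* Equal words have equal first runs, hence equal masks; dropping this prefix then identifies the
     rests. *)
  move: (congr1 (@runs _ _) E); rewrite {1}E1 {1}E2 !runs_cat // => -[ET _].
  have Em : m1 = m2 by rewrite -(map_mem_mask us szm1) ET map_mem_mask.
  by case: E; rewrite ET => /(congr1 (drop (size (mask m2 s))));
     rewrite !drop_size_cat // Em => ->.
- rewrite mem_filter mem_permutations inE.
  apply/andP/orP => [[Hw Pw]|[/eqP->|]]; last 2 first.
  + by rewrite runsorted_path.
  + case/memsplit=> m [w' [szm Hm Pw' Hw' ->]].
    have [y [u [Ew' ys pa Hl]]] := split_runs _ _ szm Hm Pw' Hw'.
    rewrite perm_cons {1}Ew' runsorted_cat // -Ew' Hw' andbT.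
    rewrite (ltW (allP (lt_path_min Hs) _ ys)); split=> //.
    by apply: perm_trans (perm_mask_negb szm); rewrite perm_cat2l.
  have [w' Ew] := runsorted_perm_head (Hs : sorted _ (a :: s)) (erefl _) Pw Hw.
  rewrite {}Ew perm_cons in Pw Hw *.
  case: (runsorted_split Hw) => [pw|[r [y [u [Ew' pr Hl _ Hu]]]]]; [left|right].
    apply/eqP; congr (_ :: _); apply: lt_sorted_eq (perm_mem Pw).
    - exact: path_sorted pw.
    - exact: path_sorted Hs.
  (* The mask selects the letters of the first run [r]; as [r] is increasing, [mask m s] returns it
     in the same order. *)
  pose m := [seq x \in r | x <- s].
  have szm : size m = size s by rewrite size_map.
  have ET : mask m s = r.
    rewrite /m -filter_mask; apply: lt_sorted_eq.
    - exact: lt_sorted_filter (path_sorted Hs).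
    - exact: path_sorted pr.
    move=> x; rewrite mem_filter andb_idr // => xr.
    by rewrite -(perm_mem Pw) Ew' mem_cat xr.
  have PU : perm_eq (y :: u) (mask (map negb m) s).
    rewrite -(perm_cat2l r) -Ew' -ET (perm_trans Pw) // perm_sym.
    exact: perm_mask_negb.
  apply/memsplit; exists m, (y :: u); split; rewrite ?ET ?Ew' //.
  apply/eqP => Es; move: Hs; rewrite -Es cat_path => /andP[_].
  move/lt_path_min/allP/(_ y); rewrite -(perm_mem PU) mem_head => /(_ isT).
  by rewrite ltNge Hl.
Qed.

End Weight.

Arguments weight : simpl never.

(** * The recurrence for weighted sums over run-sorted arrangements *)

Section Recurrence.
Variables (R : comNzRingType) (v : nat -> R).

Section SumWeight.
Variables (d : Order.disp_t) (T : orderType d).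
Implicit Types (x y : T) (w s : seq T).

Definition sum_weight s := \sum_(w <- runsorted_perms s) weight v w.

Lemma sum_weight_cons a s : path <%O a s ->
  sum_weight (a :: s) = 1 +
    \sum_(m : (size s).-tuple bool | mask m s ++ mask (map negb m) s != s)
      v (count negb m) * sum_weight (mask (map negb m) s).
Proof.
move=> Hs; have sS := path_sorted Hs.
rewrite /sum_weight (perm_big _ (perm_runsorted_perms Hs)) big_cons.
rewrite weight_path //; congr (_ + _).
rewrite big_allpairs_dep big_filter big_map big_enum_cond /=.
apply: eq_bigr => m; rewrite (mask_descent Hs) ?size_tuple //.
have szU : size (mask (map negb m) s) = count negb m.
  by rewrite size_mask ?size_map ?size_tuple // count_map.
case EU: (mask _ s) szU => [|y U] // szU Hl.
rewrite big_distrr /= big_seq_cond [RHS]big_seq_cond.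
apply: eq_bigr => w; rewrite mem_filter mem_permutations andbT.
have sU : sorted <%O (y :: U) by rewrite -EU lt_sorted_mask.
case/andP=> Hw Pw; have [w' Ew] := runsorted_perm_head sU (erefl _) Pw Hw.
have szw : size w = count negb m by rewrite (perm_size Pw).
rewrite Ew weight_cat ?lt_path_mask -?szw ?Ew //.
(* [mask_descent] gives only a weak drop at the junction; distinctness of the letters makes it
   strict. *)
rewrite lt_neqAle Hl andbT; apply/eqP => Ey.
have : uniq (a :: mask m s ++ mask (map negb m) s).
  have /perm_uniq-> : perm_eq (a :: mask m s ++ mask (map negb m) s) (a :: s).
    by rewrite perm_cons perm_mask_negb ?size_tuple.
  exact: (lt_sorted_uniq (Hs : sorted _ (a :: s))).
rewrite EU -cat_cons cat_uniq => /and3P[_ /hasPn/(_ y (mem_head _ _))].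
by rewrite Ey mem_last.
Qed.

(** Masks are grouped by their number of unselected letters. The function [f] stands for the values
    on shorter words, so that sums over different alphabets can be compared. *)
Lemma sum_weight_rec (f : nat -> R) a s : path <%O a s ->
  (forall u, (size u <= size s)%N -> sorted <%O u ->
     sum_weight u = f (size u)) ->
  sum_weight (a :: s) =
    1 + \sum_(1 <= i < size s) ('C(size s, i)%:R - 1) * v i * f i.
Proof.
move=> Hs IH; rewrite sum_weight_cons //; congr (_ + _).
set n := size s; have us := lt_sorted_uniq (path_sorted Hs).
pose c (m : n.-tuple bool) : 'I_n.+1 := inord (count negb m).
have cE m : c m = count negb m :> nat.
  by rewrite inordK // ltnS -[in leqRHS](size_tuple m) count_size.
rewrite (partition_big c predT) //=.
transitivity (\sum_(0 <= i < n.+1) ('C(n, i)%:R - 1) * v i * f i).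
  rewrite big_mkord; apply: eq_bigr => i _.
  (* The one mask with [i] unselected letters that creates no descent; it accounts for the [- 1] in
     the coefficient. *)
  pose bad := nseq (n - i) true ++ nseq i false.
  have szbad : size bad == n by rewrite size_cat !size_nseq subnK // -ltnS.
  have cbad : count negb bad = i.
    by rewrite count_cat !count_nseq mul0n mul1n.
  rewrite (eq_bigr (fun=> v i * f i)) => [|m /andP[_ /eqP Em]]; last first.
    rewrite IH; last exact: lt_sorted_mask (path_sorted Hs).
    - by rewrite size_mask ?size_map ?size_tuple // count_map -Em cE.
    - by rewrite size_mask ?size_map ?size_tuple // -[leqRHS](size_tuple m)
         -(size_map negb m) count_size.
  rewrite sumr_const -[LHS]mulr_natl mulrA; congr (_ * _ * _).
  rewrite -card_tuple_count (cardsD1 (Tuple szbad)) inE /= cbad eqxx.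
  rewrite natrD addrC addKr; congr (_%:R); apply: eq_card => m.
  rewrite !inE unfold_in /= mask_cat_negbP ?size_tuple //.
  rewrite -[m == _]val_eqE -[c m == i]val_eqE /= cE.
  by apply: andb_id2r => /eqP ->.
(* The terms for [i = 0] and [i = n] vanish because their binomial coefficient is 1. *)
rewrite big_nat_recl // bin0 subrr !mul0r add0r.
case: n {c cE} => [|n]; first by rewrite !big_geq.
by rewrite big_nat_recr //= big_add1 /= binn subrr !mul0r addr0.
Qed.

End SumWeight.

(** * From words back to permutations *)

Lemma weight_prod d (T : orderType d) (x0 : T) w : weight v w =
  \prod_(1 <= k < size w | (nth x0 w k < nth x0 w k.-1)%O) v (size w - k)%N.
Proof.
elim: w => [|x [|y w] IHw]; first by rewrite big_geq.
  by rewrite big_geq // /weight mulr1.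
rewrite weight_cons IHw [RHS]big_add1 [RHS]big_ltn_cond //.
(* Prepending [x] turns the index [k.-1] into [k]; this is valid only for positive [k], so the range
   must be kept. *)
have -> : \prod_(1 <= k < size (y :: w) |
              (nth x0 (y :: w) k < nth x0 (y :: w) k.-1)%O) v (size (y :: w) - k)%N =
          \prod_(1 <= k < size (y :: w) |
              (nth x0 (y :: w) k < nth x0 [:: x, y & w] k)%O)
              v (size [:: x, y & w] - k.+1)%N.
  by rewrite big_nat_cond [RHS]big_nat_cond; apply: eq_big => -[|k].
by rewrite /=; case: ifP => _; rewrite ?mul1r.
Qed.

(** The sum defining [A], evaluated at arbitrary ring elements [v i]. *)
Definition RSP_poly n := \sum_(p in RSP n) \prod_(j in DES p) v (n - j)%N.

Lemma oneline_inj n : injective (@oneline n).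
Proof.
move=> p q E; apply/permP => i; have /eq_in_map := E.
by apply; rewrite mem_enum.
Qed.

Lemma onelineP n (w : seq 'I_n) : perm_eq w (enum 'I_n) ->
  exists p, oneline p = w.
Proof.
move=> Pw; have szw : size w == n by rewrite (perm_size Pw) size_enum_ord.
have f_inj : injective (tnth (Tuple szw)).
  by apply/tuple_uniqP; rewrite /= (perm_uniq Pw) enum_uniq.
exists (perm f_inj); rewrite -[RHS](map_tnth_enum (Tuple szw)).
by apply: eq_map => i; rewrite permE.
Qed.

Lemma oneline_perm n (p : 'S_n) : perm_eq (oneline p) (enum 'I_n).
Proof.
apply: uniq_perm; rewrite ?enum_uniq //.
  by rewrite map_inj_uniq ?enum_uniq //; exact: perm_inj.
move=> i; rewrite mem_enum; apply/mapP.
by exists (p^-1%g i); rewrite ?mem_enum ?permKV.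
Qed.

(** A run-sorted permutation is fixed by [runsort], hence is its own preimage. *)
Lemma mem_RSP n (p : 'S_n) : (p \in RSP n) = runsorted (oneline p).
Proof.
apply/imsetP/idP => [[q _ ->]|Hp].
  by rewrite oneline_runsort runsorted_runsort_word.
exists p; rewrite ?inE //; apply: oneline_inj.
rewrite oneline_runsort runsort_word_id //.
by rewrite (perm_uniq (oneline_perm p)) enum_uniq.
Qed.

Lemma weight_oneline n (p : 'S_n) :
  weight v (oneline p) = \prod_(j in DES p) v (n - j)%N.
Proof.
case: n p => [|n] p.
  rewrite [oneline p]size0nil ?size_oneline // big_pred0 // => j.
  by case: j.
rewrite (weight_prod ord0) size_oneline big_geq_mkord; apply: eq_bigl => j.
have nthp i : (i < n.+1)%N -> nth ord0 (oneline p) i = p (inord i).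
  move=> lti; rewrite (nth_map ord0) ?size_enum_ord //; congr (p _).
  by apply: val_inj; rewrite /= nth_enum_ord // inordK.
rewrite inE; apply/andP/existsP => [[]|[i /andP[/eqP Ei lt_p]]].
  (* The position before the descent, required by [DES], is [j.-1]. *)
  have lt_pred : (j.-1 < n.+1)%N by rewrite (leq_ltn_trans (leq_pred _)).
  rewrite !nthp // inord_val => lt_p j_gt0.
  exists (inord j.-1); apply/andP; split; last exact: lt_p.
  by rewrite inordK // prednK.
have Ej : j.-1 = i by rewrite -Ei.
by rewrite Ej !nthp ?ltn_ord // !inord_val -Ei.
Qed.

Lemma RSP_poly_weight n : RSP_poly n = sum_weight (enum 'I_n).
Proof.
rewrite /RSP_poly /sum_weight -big_enum /=.
transitivity (\sum_(w <- [seq oneline p | p <- enum (RSP n)]) weight v w).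
  by rewrite big_map; apply: eq_bigr => p _; rewrite weight_oneline.
apply: perm_big; apply: uniq_perm.
- by rewrite map_inj_uniq ?enum_uniq //; exact: oneline_inj.
- by rewrite filter_uniq ?permutations_uniq.
move=> w; rewrite mem_filter mem_permutations.
apply/mapP/andP => [[p]|[Hw /onelineP[p Ep]]].
  by rewrite mem_enum mem_RSP => Hp ->; rewrite Hp oneline_perm.
by exists p; rewrite ?mem_enum ?mem_RSP ?Ep.
Qed.

Lemma sorted_enum_ord n : sorted <%O (enum 'I_n).
Proof.
have : sorted ltn (map val (enum 'I_n)) by rewrite val_enum_ord iota_ltn_sorted.
by rewrite sorted_map.
Qed.

(** The sum over [s] and the one over the ordinals obey the same recurrence, so they agree by
    induction on the length. *)
Lemma sum_weight_size d (T : orderType d) (s : seq T) :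
  sorted <%O s -> sum_weight s = RSP_poly (size s).
Proof.
move: {2}(size s) (leqnn (size s)) => k.
(* The alphabet is generalised too: the hypothesis is applied both over [T] and over the
   ordinals. *)
elim: k => [|k IHk] in d T s *.
  rewrite leqn0 size_eq0 => /eqP-> _; rewrite RSP_poly_weight.
  by rewrite (size0nil (size_enum_ord 0)) /sum_weight /runsorted_perms /= !big_seq1.
case: s => [|a s]; first by move=> _; apply: IHk.
rewrite ltnS => les Hs; rewrite (sum_weight_rec Hs (f := RSP_poly)); last first.
  by move=> u leu; apply: IHk; exact: leq_trans les.
rewrite RSP_poly_weight /=.
have := sorted_enum_ord (size s).+1; have := size_enum_ord (size s).+1.
case: (enum _) => [|b t] //= [szt] Ht.
rewrite (sum_weight_rec Ht (f := RSP_poly)) ?szt // => u leu; apply: IHk.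
exact: leq_trans les.
Qed.

Lemma RSP_poly_rec n : (1 <= n)%N ->
  RSP_poly n = 1 + \sum_(1 <= i < n.-1) ('C(n.-1, i)%:R - 1) * v i * RSP_poly i.
Proof.
case: n => // n _; rewrite RSP_poly_weight /=.
have := sorted_enum_ord n.+1; have := size_enum_ord n.+1.
case: (enum _) => [|b t] //= [szt] Ht.
rewrite (sum_weight_rec Ht (f := RSP_poly)) ?szt // => u _.
exact: sum_weight_size.
Qed.

Lemma RSP_poly_rec_pred n : (2 <= n)%N ->
  RSP_poly n =
    RSP_poly n.-1 + \sum_(1 <= i < n.-1) 'C(n.-2, i.-1)%:R * v i * RSP_poly i.
Proof.
case: n => [|[|n]] // _; rewrite !RSP_poly_rec //= -addrA; congr (_ + _).
(* Adding the zero term [i = n] gives both sums the same range, so Pascal's rule applies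
   termwise. *)
have -> : \sum_(1 <= i < n) ('C(n, i)%:R - 1) * v i * RSP_poly i =
          \sum_(1 <= i < n.+1) ('C(n, i)%:R - 1) * v i * RSP_poly i.
  case: n => [|n]; first by rewrite !big_geq.
  by rewrite [RHS]big_nat_recr //= binn subrr !mul0r addr0.
rewrite -big_split /=; apply: eq_big_nat => -[|i] // _.
by rewrite binS /= -!mulrDl natrD addrAC.
Qed.

End Recurrence.

Theorem theorem3p1 :
  (forall n : nat, (1 <= n)%N ->
     A n = 1 + \sum_(1 <= i < n.-1) ('C(n.-1, i)%:R - 1) * X i * A i) /\
  (forall n : nat, (2 <= n)%N ->
     A n = A n.-1 + \sum_(1 <= i < n.-1) 'C(n.-2, i.-1)%:R * X i * A i).
Proof.
split; [exact: (RSP_poly_rec X) | exact: (RSP_poly_rec_pred X)].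
Qed.
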